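(* Consider the signed network $\dot{x}_i(t)=u_i(t)$, $i\in\{1,\dots,n\}$, whose communication topology is described by a strongly connected signed digraph $\mathcal{G}=(\mathcal{V},\mathcal{E},A)$ on $n$ nodes, and let the following protocol be applied: $$u_i=k_1\left(-\sum_{v_j\in N(i)}|\hat{a}_{ij}|\left(x_i-\mathrm{sgn}(\hat{a}_{ij})x_j\right)\right)^{\frac{m}{r}}+k_2\left(-\sum_{v_j\in N(i)}|\hat{a}_{ij}|\left(x_i-\mathrm{sgn}(\hat{a}_{ij})x_j\right)\right)^{\frac{p}{q}},\quad i\in\{1,\dots,n\},$$ where $k_1>0$ and $k_2>0$ are control gains, $m,r,p,q$ are positive odd integers satisfying $m>r$ and $q>p$, $N(i)=\{v_j:(v_j,v_i)\in\mathcal{E}\}$ is the set of neighbors of $v_i$ in $\mathcal{G}$, and $\hat{a}_{ij}$ are the weights of the mirror signed graph $\hat{\mathcal{G}}$ of $\mathcal{G}$. Let $\lambda_1(\hat L)\le\lambda_2(\hat L)\le\cdots\le\lambda_n(\hat L)$ be the eigenvalues of the Laplacian matrix $\hat{L}$ of $\hat{\mathcal{G}}$. If $\mathcal{G}$ is structurally balanced, then the signed network achieves fixed-time bipartite consensus, and the setting time $T$ satisfies $$T\leq \frac{1}{\lambda_2(\hat{L})}\left(\frac{n^{\frac{m-r}{2r}}}{k_1}\frac{r}{m-r}+\frac{1}{k_2}\frac{q}{q-p}\right).$$ If $\mathcal{G}$ is structurally unbalanced, then the signed network achieves fixed-time state stability, and the setting time $T$ satisfies $$T\leq \frac{1}{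\lambda_1(\hat{L})}\left(\frac{n^{\frac{m-r}{2r}}}{k_1}\frac{r}{m-r}+\frac{1}{k_2}\frac{q}{q-p}\right).$$
   Context: A signed digraph $\mathcal{G}=(\mathcal{V},\mathcal{E},A)$ has node set $\mathcal{V}=\{v_1,\dots,v_n\}$, edge set $\mathcal{E}\subseteq\mathcal{V}\times\mathcal{V}$, and real weight matrix $A=[a_{ij}]\in\mathbb{R}^{n\times n}$ with $a_{ij}\neq0\Leftrightarrow(v_j,v_i)\in\mathcal{E}$. It is assumed that there are no self-loops ($a_{ii}=0$ for all $i$) and that the digraph is digon sign-symmetric ($a_{ij}a_{ji}\ge0$ for all $i,j$). $\mathcal{G}$ is strongly connected if there is a directed path between every distinct pair of nodes (in each direction). $\mathcal{G}$ is structurally balanced if $\mathcal{V}$ can be separated into two disjoint subsets $\mathcal{V}_1,\mathcal{V}_2$ (one of which may be empty) with $a_{ij}\ge0$ whenever $v_i,v_j$ lie in the same subset and $a_{ij}\le0$ whenever they lie in different subsets; otherwise $\mathcal{G}$ is structurally unbalanced. Induced unsigned digraph: $\overline{\mathcal{G}}=(\mathcal{V},\mathcal{E},\overline{A})$ with $\overline{A}=[|a_{ij}|]$; its Laplacian is $\overline{L}=\Delta-\overline{A}$, where $\Delta=\mathrm{diag}\{\sum_{j=1}^n|a_{1j}|,\dots,\sum_{j=1}^n|a_{nj}|\}$. $\overline{L}_{ii}\in\mathbb{R}^{(n-1)\times(n-1)}$ denotes $\overline{L}$ with its $i$th row and $i$th column removed. Mirror signed graph: $\hat{\mathcal{G}}$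 is the undirected signed graph on $\mathcal{V}$ with symmetric weight matrix $\hat{A}=[\hat{a}_{ij}]$, $\hat{a}_{ij}=\frac{1}{2}\left(\det(\overline{L}_{ii})a_{ij}+\det(\overline{L}_{jj})a_{ji}\right)$. Its Laplacian is the symmetric matrix $\hat{L}=\hat{\Delta}-\hat{A}$ with $\hat{\Delta}=\mathrm{diag}\{\sum_{j}|\hat{a}_{1j}|,\dots,\sum_j|\hat{a}_{nj}|\}$. $\mathrm{sgn}$ is the sign function; for odd positive integers $a,b$ and $y\in\mathbb{R}$, $y^{a/b}$ is the real number $(y^{1/b})^a$ with $y^{1/b}$ the real $b$th root. Fixed-time bipartite consensus: for any initial states $x_i(0)\in\mathbb{R}$, there exist scalars $\sigma_i\in\{\pm1\}$ and $c\neq0$ such that $\lim_{t\to T}x_i(t)=\sigma_ic$ and $x_i(t)=\sigma_ic$ for all $t\ge T$, for every $i\in\{1,\dots,n\}$. Fixed-time state stability: for any initial states, $\lim_{t\to T}x_i(t)=0$ and $x_i(t)=0$ for all $t\ge T$, for every $i\in\{1,\dots,n\}$. In both cases $T\in[0,\infty)$ is the setting time, which is independent of the initial states.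
   Formalization: N(i) is taken as the neighbours of v_i in the mirror graph, since with neighbours in G the bound fails (e.g. a unit directed 3-cycle, p/q near 1); c≠0 is required only for initial states off a closed set meeting each line of one direction at most once, since x(0)=0 gives c=0. *)

(* Defs.v *)
From mathcomp Require Import all_boot all_order all_algebra.
From mathcomp Require Import all_classical all_reals all_analysis.

Set Implicit Arguments.
Unset Strict Implicit.
Unset Printing Implicit Defensive.

Import Order.TTheory GRing.Theory Num.Theory.
Import numFieldNormedType.Exports.

Local Open Scope classical_set_scope.
Local Open Scope ring_scope.

(* A signed digraph on {v_i : i < n} is given by its weight matrix [A]: there *)
(* is an edge from v_j to v_i exactly when [A i j != 0].                      *)

Definition edge (R : realType) (n : nat) (A : 'M[R]_n) : rel 'I_n :=
  fun j i => A i j != 0.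

Definition signed_digraph (R : realType) (n : nat) (A : 'M[R]_n) : Prop :=
  (forall i, A i i = 0) /\ (forall i j, 0 <= A i j * A j i).

Definition strongly_connected (R : realType) (n : nat) (A : 'M[R]_n) : Prop :=
  forall i j, connect (edge A) i j.

(* The two classes are [V1] and its complement; either may be empty. *)
Definition structurally_balanced (R : realType) (n : nat) (A : 'M[R]_n) : Prop :=
  exists V1 : {set 'I_n}, forall i j,
    if (i \in V1) == (j \in V1) then 0 <= A i j else A i j <= 0.

Definition neighbours (R : realType) (n : nat) (A : 'M[R]_n) (i : 'I_n) :
  {set 'I_n} := [set j | edge A j i].

Definition laplacian (R : realType) (n : nat) (A : 'M[R]_n) : 'M[R]_n :=
  diag_mx (\row_i \sum_j `|A i j|) - A.

Definition unsigned (R : realType) (n : nat) (A : 'M[R]_n) : 'M[R]_n :=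
  map_mx Num.norm A.

Definition principal_minor (R : realType) (n : nat) (L : 'M[R]_n) (i : 'I_n) : R :=
  \det (row' i (col' i L)).

Definition mirror (R : realType) (n : nat) (A : 'M[R]_n) : 'M[R]_n :=
  let d := principal_minor (laplacian (unsigned A)) in
  \matrix_(i, j) (2^-1 * (d i * A i j + d j * A j i)).

(* Eigenvalues are listed in nondecreasing order with multiplicity, so the    *)
(* k-th smallest one is [lam`_(k-1)].                                         *)
Definition ordered_spectrum (R : realType) (n : nat) (L : 'M[R]_n)
    (lam : seq R) : Prop :=
  sorted <=%R lam /\ char_poly L = \prod_(a <- lam) ('X - a%:P).

Definition odd_root (R : realType) (b : nat) (y : R) : R :=
  Num.sg y * `|y| `^ (b%:R^-1).

Lemma odd_rootK (R : realType) (b : nat) (y : R) :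
  odd b -> odd_root b y ^+ b = y.
Proof.
move=> bodd; have b0 : b%:R != 0 :> R by rewrite pnatr_eq0; case: b bodd.
rewrite /odd_root exprMn -(powR_mulrn b (powR_ge0 _ _)) -powRrM mulVf//.
rewrite powRr1//; case: (sgrP y) => [->|y0|y0].
- by rewrite mulr0.
- by rewrite expr1n mul1r.
- by rewrite -signr_odd bodd expr1 mulN1r opprK.
Qed.

Definition odd_pow (R : realType) (a b : nat) (y : R) : R := odd_root b y ^+ a.

(* [W] is the weight matrix of the graph over which the agents communicate. *)
Definition protocol (R : realType) (n : nat) (W : 'M[R]_n) (k1 k2 : R)
    (m r p q : nat) (x : 'cV[R]_n) (i : 'I_n) : R :=
  let e := - \sum_(j in neighbours W i)
               `|W i j| * (x i 0 - Num.sg (W i j) * x j 0) in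
  k1 * odd_pow m r e + k2 * odd_pow p q e.

(* Classical solutions on [0, +oo[; the values at negative times are          *)
(* irrelevant. The right derivative at 0 follows when [u] is continuous.      *)
Definition trajectory (R : realType) (n : nat) (u : 'cV[R]_n -> 'I_n -> R)
    (x : R -> 'cV[R]_n) : Prop :=
  forall i, {within `[0, +oo[, continuous (fun t : R => x t i 0)} /\
    forall t : R, 0 < t -> is_derive t 1 (fun s : R => x s i 0) (u (x t) i).

Definition settles (R : realType) (f : R -> R) (T l : R) : Prop :=
  f s @[s --> within `[0, +oo[ (nbhs T)] --> l /\ forall t, T <= t -> f t = l.

(* A closed set meeting every line of some fixed direction at most once; by   *)
(* Fubini such a set is Lebesgue null, and it is nowhere dense.               *)
Definition thin (R : realType) (n : nat) (Z : set 'cV[R]_n) : Prop :=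
  closed Z /\ exists2 v : 'cV[R]_n, v != 0 &
    forall z a, Z z -> Z (z + a *: v) -> a = 0.

(* The consensus value cannot be nonzero for every initial state: the origin  *)
(* is an equilibrium. It is required to be nonzero off a thin set of initial  *)
(* states, the agreement in modulus being required for all of them.           *)
Definition fixed_time_bipartite_consensus (R : realType) (n : nat)
    (u : 'cV[R]_n -> 'I_n -> R) (T : R) : Prop :=
  exists2 Z : set 'cV[R]_n, thin Z &
  forall x0 : 'cV[R]_n, exists (sigma : 'I_n -> R) (c : R),
    [/\ forall i, sigma i = 1 \/ sigma i = -1,
        ~ Z x0 -> c != 0
      & forall x, trajectory u x -> x 0 = x0 ->
          forall i, settles (fun t => x t i 0) T (sigma i * c)].

Definition fixed_time_stability (R : realType) (n : nat)
    (u : 'cV[R]_n -> 'I_n -> R) (T : R) : Prop :=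
  forall x, trajectory u x -> forall i, settles (fun t => x t i 0) T 0.

(* Main.v *)
Require Import Defs.
From mathcomp Require Import all_boot all_order all_algebra.
From mathcomp Require Import all_classical all_reals all_analysis.
From mathcomp Require Import ring lra.
From mathcomp Require Import polyrcf complex.

(* Let L be the Laplacian of the mirror graph: each agent obeys                *)
(* x_i' = phi (- (L x)_i) with phi odd and nondecreasing. If l is the least    *)
(* positive eigenvalue of L, then |L x|^2 >= l x^T L x, and power mean         *)
(* inequalities give Y' <= - (a Y^al + b Y^be), al > 1 > be, for               *)
(* Y = l x^T L x, whence Y = 0 from the announced time on. The minors of the   *)
(* unsigned Laplacian are positive, so the mirror weights keep the signs of    *)
(* the digraph and the kernel of L is trivial (unbalanced case) or spanned by  *)
(* a vector of signs (balanced case).                                          *)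
(* The consensus value has no closed form. That it depends only on the initial *)
(* state follows from the flow being nonexpansive for the sup norm; that it    *)
(* vanishes only on a thin set follows in addition from the flow commuting     *)
(* with translations along the vector of signs.                                *)

Set Implicit Arguments.
Unset Strict Implicit.
Unset Printing Implicit Defensive.

Import Order.TTheory GRing.Theory Num.Theory.
Import numFieldNormedType.Exports.

Local Open Scope ring_scope.

(** The energy x^T L x of the mirror Laplacian obeys a scalar differential inequality with one
    exponent above 1 and one below 1. Its rate comes from [rayleigh_of_spectrum]: |L x|^2 - l x^T L
    x is the quadratic form of L (L - l), which is nonnegative when no eigenvalue of the positive
    semidefinite L lies strictly between 0 and l. So l may be the least eigenvalue when the kernel
    is trivial and the second one when it is a line ([spectrum_gap_trivial], [spectrum_gap_line]);
    structural balance decides between the two, through [principal_minor_gt0] and [mirror_sg]. The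
    estimate [response_sum_ge] feeds [fixed_time_extinction], whose time is exactly the announced
    bound. Once the energy is zero the state lies in the kernel and stops moving
    ([trajectory_stationary]). In the balanced case [protocol_nonexpansive] and [trajectory_shift]
    control the consensus value. *)

(** * Spectral theory of real symmetric matrices *)

Section Spectral.
Local Open Scope sesquilinear_scope.
Variables (R : realType) (n : nat).
Implicit Types (L : 'M[R]_n) (x : 'cV[R]_n).

(** The spectral theorem is applied over the complex numbers, so [P] is complex while the
    eigenvalues [d] stay real. *)
Definition diagonalized_by (P : 'M[R[i]]_n) L (d : 'rV[R]_n) :=
  map_mx (real_complex R) L
    = P^t* *m diag_mx (map_mx (real_complex R) d) *m P.

Lemma symmetric_diagonalized L : L^T = L ->
  exists2 P : 'M[R[i]]_n, P \is unitarymx & exists d, diagonalized_by P L d.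
Proof.
move=> symL; set LC := map_mx (real_complex R) L.
have hermL : LC \is hermsymmx.
  apply: realsym_hermsym.
    by apply/is_hermitianmxP; rewrite expr0 scale1r map_mx_id // map_trmx symL.
  by apply/mxOverP => i j; rewrite mxE complex_real.
have /orthomx_spectralP LE := hermitian_normalmx hermL.
exists (spectralmx LC); first exact: spectral_unitarymx.
exists (map_mx (@complex.Re R) (spectral_diag LC)).
rewrite /diagonalized_by -/LC {1}LE invmx_unitary ?spectral_unitarymx //.
congr (_ *m diag_mx _ *m _); apply/matrixP => i j; rewrite !mxE RRe_real //.
exact: (mxOverP (hermitian_spectral_diag_real hermL)).
Qed.

Lemma diagonalized_char_poly P L d : P \is unitarymx -> diagonalized_by P L d ->
  char_poly L = \prod_i ('X - (d 0 i)%:P).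
Proof.
move=> Pu LE; apply: (map_poly_inj (real_complex R)).
pose Q := map_mx (@polyC R[i]) P; pose Q' := map_mx (@polyC R[i]) (P^t*).
have QQ : Q' *m Q = 1%:M.
  by rewrite -map_mxM -invmx_unitary // mulVmx ?map_mx1 ?unitarymx_unit.
rewrite map_char_poly LE.
set D := diag_mx _; transitivity (char_poly D).
  rewrite /char_poly /char_poly_mx.
  have -> : 'X%:M - map_mx polyC (P^t* *m D *m P) =
            Q' *m ('X%:M - map_mx polyC D) *m Q.
    rewrite !map_mxM mulmxBr mulmxBl scalar_mxC.
    by rewrite -['X%:M *m _ *m _]mulmxA QQ mulmx1.
  rewrite !det_mulmx mulrAC -det_mulmx QQ det1 mul1r //.
rewrite char_poly_trig ?diag_mx_is_trig //.
rewrite rmorph_prod; apply: eq_bigr => i _.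
by rewrite !mxE eqxx mulr1n rmorphB /= map_polyX map_polyC.
Qed.

Lemma diagonalized_quadratic P L d x : diagonalized_by P L d ->
  ((x^T *m L *m x) 0 0)%:C%C =
  \sum_i (d 0 i)%:C%C * `|(P *m map_mx (real_complex R) x) i 0| ^+ 2.
Proof.
move=> LE; set xC := map_mx _ x.
have -> : ((x^T *m L *m x) 0 0)%:C%C
          = ((P *m xC)^t* *m (diag_mx (map_mx (real_complex R) d) *m (P *m xC))) 0 0.
  transitivity (map_mx (real_complex R) (x^T *m L *m x) 0 0); first by rewrite [RHS]mxE.
  have xT : map_mx (real_complex R) x^T = xC^t*.
    apply/matrixP => i j; rewrite !mxE conj_Creal //.
    by apply/complex_realP; exists (x j i).
  by rewrite !map_mxM LE xT trmx_mul map_mxM !mulmxA.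
move: (P *m xC) => y; rewrite mul_diag_mx [LHS]mxE; apply: eq_bigr => i _.
by rewrite !mxE normCK mulrCA [y i 0 * _]mulrC.
Qed.

Lemma diagonalized_sqr P L d l : P \is unitarymx -> diagonalized_by P L d ->
  diagonalized_by P (L *m L - l *: L) (\row_i (d 0 i * (d 0 i - l))).
Proof.
move=> Pu LE; set D := diag_mx (map_mx (real_complex R) d).
have DE : diag_mx (map_mx (real_complex R) (\row_i (d 0 i * (d 0 i - l))))
          = D *m D - l%:C%C *: D.
  apply/matrixP => i j; rewrite mul_diag_mx !mxE; case: eqVneq => [->|_] /=.
    by rewrite !mulr1n rmorphM rmorphB /= mulrBr [X in _ - X]mulrC.
  by rewrite !mulr0n !mulr0 subr0.
rewrite /diagonalized_by DE map_mxB map_mxZ map_mxM LE -/D.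
rewrite mulmxBr mulmxBl -scalemxAr -scalemxAl; congr (_ - _).
have PP := unitarymxP Pu.
by rewrite !mulmxA -[_ *m P *m P^t*]mulmxA PP mulmx1.
Qed.

Lemma rayleigh_of_spectrum L (lam : seq R) l x : L^T = L ->
    char_poly L = \prod_(a <- lam) ('X - a%:P) ->
    (forall a, a \in lam -> 0 <= a * (a - l)) ->
  l * (x^T *m L *m x) 0 0 <= ((L *m x)^T *m (L *m x)) 0 0.
Proof.
move=> symL cL lamP; have [P Pu [d LE]] := symmetric_diagonalized symL.
(* Both products are the characteristic polynomial, so [lam] and [d] agree as multisets. *)
have /prod_XsubC_eq/perm_mem lamd :
  \prod_(a <- lam) ('X - a%:P) = \prod_(a <- [seq d 0 i | i : 'I_n]) ('X - a%:P).
  by rewrite -cL (diagonalized_char_poly Pu LE) big_map big_enum.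
have /(diagonalized_quadratic x) := diagonalized_sqr l Pu LE.
rewrite -subr_ge0 -ler0c => q.
rewrite [X in 0 <= X](_ : _ = ((x^T *m (L *m L - l *: L) *m x) 0 0)%:C%C).
  rewrite q; apply: sumr_ge0 => i _; rewrite mulr_ge0 ?exprn_ge0 // mxE ler0c lamP //.
  by rewrite lamd; apply/mapP; exists i; rewrite ?mem_enum.
rewrite mulmxBr mulmxBl -scalemxAr -scalemxAl trmx_mul symL !mulmxA.
by congr (_%:C%C); move: (_ *m x) (_ *m x) => M N; rewrite !mxE.
Qed.

(** If 0 occurred twice, two distinct rows of the unitary [P] would be multiples of one vector,
    against their orthonormality. *)
Lemma kernel_line_simple L (lam : seq R) (v : 'cV[R]_n) : L^T = L ->
    char_poly L = \prod_(a <- lam) ('X - a%:P) ->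
    (forall x, L *m x = 0 -> exists a, x = a *: v) ->
  (count_mem 0%R lam <= 1)%N.
Proof.
move=> symL cL kerL; have [P Pu [d LE]] := symmetric_diagonalized symL.
have /prod_XsubC_eq/permP -> :
  \prod_(a <- lam) ('X - a%:P) = \prod_(a <- [seq d 0 i | i : 'I_n]) ('X - a%:P).
  by rewrite -cL (diagonalized_char_poly Pu LE) big_map big_enum.
have PP := unitarymxP Pu.
pose w := map_mx (real_complex R) v^T.
(* Such a row lies in the complex kernel of L, which is spanned by the real kernel. *)
have rowP i : d 0 i = 0 -> exists a, row i P = a *: w.
  move=> di; apply/sub_rVP; apply: (submx_trans (B := kermx (map_mx (real_complex R) L))).
    apply/sub_kermxP; rewrite LE -row_mul !mulmxA PP mul1mx row_mul row_diag_mx mxE di.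
    by rewrite scale0r mul0mx.
  rewrite -map_kermx map_submx; apply/row_subP => k; apply/sub_rVP.
  have /sub_kermxP kL := row_sub k (kermx L).
  have [|a /(congr1 trmx)] := kerL (row k (kermx L))^T.
    by rewrite -{1}[L]symL -trmx_mul kL trmx0.
  by rewrite trmxK linearZ /= => ->; exists a.
have Pij i j : (row i P *m P^t*) 0 j = (i == j)%:R by rewrite -row_mul PP !mxE.
rewrite count_map -size_filter; case E : [seq _ <- _ | _] => [//|i [//|j s]].
have : uniq [seq i <- enum 'I_n | preim (fun i => d 0 i) (pred1 0) i].
  by rewrite filter_uniq ?enum_uniq.
rewrite E /= inE negb_or => /andP[/andP[/negbTE nij _] _].
have mem k : k \in [:: i, j & s] -> d 0 k = 0.
  by rewrite -E mem_filter => /andP[/eqP].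
have [a ia] := rowP i (mem i (mem_head _ _)).
have [|b jb] := rowP j (mem j _); first by rewrite !inE eqxx orbT.
have := Pij i i; have := Pij j i; have := Pij j j.
rewrite ia jb -!scalemxAl ![_ (_ *: _) _ _]mxE !eqxx eq_sym nij => b0 b1 a0.
have z0 : (w *m P^t*) 0 i != 0.
  by apply: contra_eq_neq a0 => ->; rewrite mulr0 eq_sym oner_eq0.
move/eqP: b1; rewrite mulf_eq0 (negbTE z0) orbF => /eqP b1.
by move/eqP: b0; rewrite b1 mul0r eq_sym oner_eq0.
Qed.
End Spectral.

(** * Signed Laplacians and positivity of principal minors *)

Section Graph.
Variables (R : realType) (n : nat).
Implicit Types (A W : 'M[R]_n) (x : 'cV[R]_n).

Lemma connect_ind_rev (T : finType) (e : rel T) (P : T -> Prop) u v :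
  (forall a b, e a b -> P b -> P a) -> connect e u v -> P v -> P u.
Proof.
move=> eP /connectP[s]; elim: s u => [u _ -> //|w s IHs u /= /andP[uw ws] vE Pv].
by apply: (eP _ _ uw); exact: IHs.
Qed.

Lemma laplacian_mulE W x i :
  (laplacian W *m x) i 0 = \sum_j `|W i j| * (x i 0 - Num.sg (W i j) * x j 0).
Proof.
rewrite /laplacian mulmxBl mul_diag_mx !mxE.
rewrite mulr_suml -sumrB; apply: eq_bigr => j _.
by rewrite mulrBr mulrA [_ * Num.sg _]mulrC mulr_sg_norm.
Qed.

Lemma trmx_laplacian W : W^T = W -> (laplacian W)^T = laplacian W.
Proof. by move=> symW; rewrite /laplacian linearB /= tr_diag_mx symW. Qed.

Lemma laplacian_quadratic W x : W^T = W ->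
  (x^T *m laplacian W *m x) 0 0 =
  2^-1 * \sum_i \sum_j `|W i j| * (x i 0 - Num.sg (W i j) * x j 0) ^+ 2.
Proof.
move=> symW; have WE i j : W j i = W i j by rewrite -[in LHS]symW mxE.
pose F i j := `|W i j| * (x i 0 - Num.sg (W i j) * x j 0) * x i 0.
have qE : (x^T *m laplacian W *m x) 0 0 = \sum_i \sum_j F i j.
  rewrite -mulmxA mxE; apply: eq_bigr => i _; rewrite laplacian_mulE [X in X * _]mxE.
  by rewrite mulrC mulr_suml.
have qE' : (x^T *m laplacian W *m x) 0 0 = \sum_i \sum_j F j i.
  by rewrite qE exchange_big.
apply: (mulfI (_ : 2 != 0)); first by rewrite pnatr_eq0.
rewrite mulrA divff ?pnatr_eq0 // mul1r mulr_natl mulr2n {1}qE qE' -big_split /=.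
apply: eq_bigr => i _; rewrite -big_split; apply: eq_bigr => j _ /=.
rewrite /F (WE i j); have [->|w0] := eqVneq (W i j) 0; first by rewrite normr0; ring.
rewrite [in RHS]sqrrB exprMn sqr_sg w0 mul1r; ring.
Qed.

(** Edgewise form of the kernel of the Laplacian: the two coincide for symmetric [W]. *)
Definition agreement W x := forall i j, W i j != 0 -> x i 0 = Num.sg (W i j) * x j 0.

Lemma quadratic_ge0 W x : W^T = W -> 0 <= (x^T *m laplacian W *m x) 0 0.
Proof.
move=> symW; rewrite laplacian_quadratic // mulr_ge0 ?invr_ge0 //.
by apply: sumr_ge0 => i _; apply: sumr_ge0 => j _; rewrite mulr_ge0 ?sqr_ge0.
Qed.

Lemma quadratic_eq0_agreement W x : W^T = W ->
  (x^T *m laplacian W *m x) 0 0 = 0 -> agreement W x.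
Proof.
move=> symW /eqP; rewrite laplacian_quadratic // mulf_eq0 invr_eq0 pnatr_eq0 /=.
rewrite psumr_eq0 => [/allP sum0 i j Wij|i _]; last first.
  by apply: sumr_ge0 => j _; rewrite mulr_ge0 ?sqr_ge0.
have := sum0 i; rewrite mem_index_enum => /(_ isT) /=.
rewrite psumr_eq0 => [/allP/(_ j)|k _]; last by rewrite mulr_ge0 ?sqr_ge0.
rewrite mem_index_enum => /(_ isT) /=.
by rewrite mulf_eq0 normr_eq0 (negbTE Wij) /= sqrf_eq0 subr_eq0 => /eqP.
Qed.

Lemma agreement_laplacian0 W x : agreement W x -> laplacian W *m x = 0.
Proof.
move=> ag; apply/colP => i; rewrite laplacian_mulE mxE big1 // => j _.
by case: (eqVneq (W i j) 0) => [->|/ag->]; rewrite ?normr0 ?mul0r // subrr mulr0.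
Qed.

Lemma laplacian0_agreement W x : W^T = W -> laplacian W *m x = 0 -> agreement W x.
Proof.
move=> symW Lx; apply: quadratic_eq0_agreement => //.
by rewrite -mulmxA Lx mulmx0 mxE.
Qed.

(* The characteristic polynomial of minus the minor has no root t >= 0 by the *)
(* maximum principle along paths ending at the largest entry of a kernel      *)
(* vector, and it is positive for large t.                                    *)
Lemma principal_minor_gt0 A i : strongly_connected A ->
  0 < principal_minor (laplacian (unsigned A)) i.
Proof.
case: n A i => [A []//|n' A i connA].
rewrite /principal_minor; set M := row' i (col' i _).
(* Eigenvectors are row vectors; the transpose turns a root t into a solution of M y = - t y. *)
pose p := char_poly (- M^T).
have p0 : p.[0] = \det M.
  rewrite horner_coef0 char_poly_det -[- M^T]scaleN1r detZ det_tr mulrA -exprMn.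
  by rewrite mulN1r opprK expr1n mul1r.
have noroot t : 0 <= t -> ~~ root p t.
  move=> t0; rewrite -eigenvalue_root_char; apply/negP => /eigenvalueP[v vM v0].
  (* The eigenvector is extended by 0 at the removed node [i]. *)
  pose y k := if unlift i k is Some k' then v 0 k' else 0.
  have yi : y i = 0 by rewrite /y unlift_none.
  have ylift k : y (lift i k) = v 0 k by rewrite /y liftK.
  have yE k : y k != 0 -> \sum_j `|A k j| * (y k - y j) = - t * y k.
    case: (unliftP i k) => [k' -> yk|->]; last by rewrite yi eqxx.
    have := congr1 (fun w : 'rV_n' => w 0 k') vM.
    rewrite mulmxN !mxE => /(congr1 -%R); rewrite opprK -ylift mulNr => <-.
    under [RHS]eq_bigr do rewrite !mxE (inj_eq lift_inj).
    rewrite (bigD1_ord i) //= yi subr0.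
    under [RHS]eq_bigr do rewrite mulrBr.
    rewrite sumrB [X in _ = X - _](bigD1 k') //= eqxx mulr1n.
    rewrite [X in _ = _ + X - _]big1 ?addr0; last first.
      by move=> j /negbTE jk; rewrite eq_sym jk mulr0n mulr0.
    under [X in v 0 k' * X]eq_bigr do rewrite mxE normr_id.
    rewrite (bigD1_ord i) //= mulrDr mulr_sumr -addrA -sumrB -ylift.
    by rewrite mulrC; congr (_ + _); apply: eq_bigr => j _; rewrite -ylift; ring.
  pose k0 := [arg max_(k > i) `|y k|]%O.
  have ymax k : `|y k| <= `|y k0|.
    by rewrite /k0; case: arg_maxP => // m _; apply.
  have y0 : 0 < `|y k0|.
    have [k vk] : exists k, v 0 k != 0.
      apply/existsP; apply: contraNT v0; rewrite negb_exists => /forallP h.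
      by apply/eqP/rowP => k; rewrite mxE; apply/eqP; have := h k; rewrite negbK.
    by apply: lt_le_trans (ymax (lift i k)); rewrite ylift normr_gt0.
  suff : `|y i| = `|y k0| by move=> yik; move: y0; rewrite -yik yi normr0 ltxx.
  apply: (connect_ind_rev (P := fun k => `|y k| = `|y k0|)) (connA i k0) _ => //.
  move=> a b; rewrite /edge => ab yb.
  have yb0 : y b != 0 by rewrite -normr_gt0 yb.
  have term_ge0 j : 0 <= `|A b j| * (`|y b| - Num.sg (y b) * y j).
    rewrite mulr_ge0 // subr_ge0 yb; apply: le_trans (ymax j).
    by apply: (le_trans (ler_norm _)); rewrite normrM normr_sg yb0 mul1r.
  (* At a node of maximal modulus this sum of nonnegative terms equals - t |y b|, so every term
     vanishes and each in-neighbour of [b] is maximal too. Following a path from [i] to [k0]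
     backwards, the maximum reaches [i], where y is 0. *)
  have : \sum_j `|A b j| * (`|y b| - Num.sg (y b) * y j) <= 0.
    have -> : \sum_j `|A b j| * (`|y b| - Num.sg (y b) * y j) =
              Num.sg (y b) * \sum_j `|A b j| * (y b - y j).
      rewrite mulr_sumr; apply: eq_bigr => j _.
      by rewrite [`|y b|]normrEsg; ring.
    by rewrite yE // mulrCA -normrEsg mulNr oppr_le0 mulr_ge0.
  rewrite le_eqVlt ltNge sumr_ge0 // orbF psumr_eq0 // => /allP/(_ a).
  rewrite mem_index_enum => /(_ isT) /=; rewrite mulf_eq0 normr_eq0 (negbTE ab) /=.
  rewrite subr_eq0 => /eqP yab; rewrite -yb; apply/eqP; rewrite eq_le yb ymax /=.
  by rewrite -yb yab; apply: (le_trans (ler_norm _)); rewrite normrM normr_sg yb0 mul1r.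
rewrite -p0 lt_neqAle eq_sym -rootE noroot //= leNgt; apply/negP => pneg.
have lp : lead_coef p = 1 by apply/eqP; rewrite -monicE char_poly_monic.
have [|b pb] := @poly_pinfty_gt_lc _ p; first by rewrite lp.
have b0 : 0 <= Num.max 0 b by rewrite le_max lexx.
have [|t /andP[t0 _] rt] := @poly_ivt _ p 0 (Num.max 0 b) b0.
  rewrite ltW //=; apply: le_trans (pb _ _); first by rewrite lp.
  by rewrite le_max lexx orbT.
by have := noroot t t0; rewrite rt.
Qed.
End Graph.

(** * Signs of the mirror graph and its agreement vectors *)

Section Mirror.
Variables (R : realType) (n : nat) (A : 'M[R]_n).
Hypotheses (hA : signed_digraph A) (hconn : strongly_connected A).
Implicit Types (x : 'cV[R]_n).

Lemma trmx_mirror : (mirror A)^T = mirror A.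
Proof. by apply/matrixP => i j; rewrite !mxE addrC. Qed.

Lemma mirror_ge0 i j : 0 <= A i j -> 0 <= A j i -> 0 <= mirror A i j.
Proof.
move=> a b; rewrite mxE mulr_ge0 ?invr_ge0 // addr_ge0 // mulr_ge0 //.
  by rewrite ltW ?principal_minor_gt0.
by rewrite ltW ?principal_minor_gt0.
Qed.

Lemma mirror_le0 i j : A i j <= 0 -> A j i <= 0 -> mirror A i j <= 0.
Proof.
move=> a b; have di := principal_minor_gt0 i hconn.
have dj := principal_minor_gt0 j hconn.
by rewrite mxE pmulr_rle0 ?invr_gt0 // -oppr_ge0 opprD addr_ge0 ?oppr_ge0 ?pmulr_rle0.
Qed.

(** Digon sign-symmetry excludes cancellation: with positive minors both summands have the same weak
    sign, and the first is nonzero. *)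
Lemma mirror_sg i j : A i j != 0 -> Num.sg (mirror A i j) = Num.sg (A i j).
Proof.
have di := principal_minor_gt0 i hconn; have dj := principal_minor_gt0 j hconn.
have := hA.2 i j; rewrite mxE; case: (ltrgt0P (A i j)) => // a.
  rewrite pmulr_rge0 // => b _.
  by rewrite !gtr0_sg // mulr_gt0 ?invr_gt0 // ltr_wpDr ?mulr_ge0 ?mulr_gt0 // ltW.
rewrite nmulr_rge0 // => b _.
by rewrite !ltr0_sg // pmulr_rlt0 ?invr_gt0 // ltr_wnDr ?pmulr_rle0 ?pmulr_rlt0.
Qed.

Lemma mirror_neq0 i j : A i j != 0 -> mirror A i j != 0.
Proof. by move=> aij; rewrite -sgr_eq0 mirror_sg // sgr_eq0. Qed.

Lemma agreement_norm x i j : agreement (mirror A) x -> `|x i 0| = `|x j 0|.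
Proof.
move=> ag; apply: (connect_ind_rev (P := fun k => `|x k 0| = `|x j 0|)) (hconn i j) _ => //.
move=> a b; rewrite /edge => /mirror_neq0 ab <-.
by rewrite (ag _ _ ab) normrM normr_sg ab mul1r.
Qed.

(** By strong connectivity a nonzero agreement vector has no zero entry, and its signs would then
    give a balanced bipartition. *)
Lemma unbalanced_agreement_eq0 x :
  ~ structurally_balanced A -> agreement (mirror A) x -> x = 0.
Proof.
move=> unb ag; apply/eqP/negPn/negP => x0; apply: unb.
have [i0 xi0] : exists i, x i 0 != 0.
  apply/existsP; apply: contraNT x0; rewrite negb_exists => /forallP h.
  by apply/eqP/colP => k; rewrite mxE; apply/eqP; have := h k; rewrite negbK.
have xn0 i : x i 0 != 0 by rewrite -normr_eq0 (agreement_norm i i0 ag) normr_eq0.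
exists [set i | 0 < x i 0] => i j; rewrite !inE.
have [->|aij] := eqVneq (A i j) 0; first by rewrite lexx if_same.
rewrite (ag _ _ (mirror_neq0 aij)) mirror_sg //.
case: (ltrgt0P (A i j)) aij => // a _.
  by rewrite (gtr0_sg a) mul1r eqxx.
rewrite (ltr0_sg a) mulN1r oppr_gt0; case: (ltrgt0P (x j 0)) (xn0 j) => //.
Qed.

(** The signs of the bipartition agree along every edge, and for any other agreement vector x the
    product s_k x_k is constant along edges, hence everywhere. *)
Lemma balanced_agreement (i0 : 'I_n) : structurally_balanced A ->
  exists s : 'cV[R]_n,
    [/\ forall i, s i 0 = 1 \/ s i 0 = -1, agreement (mirror A) s &
        forall x, agreement (mirror A) x -> exists a, x = a *: s].
Proof.
move=> [V1 V1P]; pose s : 'cV[R]_n := \col_i (if i \in V1 then 1 else -1).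
have s1 i : s i 0 = 1 \/ s i 0 = -1 by rewrite mxE; case: ifP; [left|right].
have ss i : s i 0 * s i 0 = 1 by case: (s1 i) => ->; ring.
have ags : agreement (mirror A) s.
  move=> i j wij; rewrite [s i 0]mxE [s j 0]mxE; have := V1P i j; have := V1P j i.
  rewrite eq_sym; case: ifP => [/eqP ->|h] a b.
    have := mirror_ge0 b a; rewrite le0r (negbTE wij) /= => /gtr0_sg ->.
    by rewrite mul1r.
  have := mirror_le0 b a; rewrite le_eqVlt (negbTE wij) /= => /ltr0_sg ->.
  by rewrite mulN1r; move: h; do 2! case: (_ \in V1); rewrite ?opprK.
exists s; split=> // x ag; exists (s i0 0 * x i0 0); apply/colP => i.
suff <- : s i 0 * x i 0 = s i0 0 * x i0 0 by rewrite mxE mulrAC ss mul1r.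
apply: (connect_ind_rev (P := fun k => s k 0 * x k 0 = s i0 0 * x i0 0)) (hconn i i0) _ => //.
move=> a b; rewrite /edge => /mirror_neq0 ab <-.
rewrite (ag _ _ ab) (ags _ _ ab) mulrACA -expr2 sqr_sg ab mul1r //.
Qed.
End Mirror.

(** * Odd powers and power mean inequalities *)

Section Powers.
Variable R : realType.
Implicit Types (x y s : R).

Lemma exprn_odd_homo (a : nat) : odd a -> {homo (fun x => x ^+ a) : x y / x <= y}.
Proof.
move=> oa x y xy; have [x0|x0] := leP 0 x.
  by rewrite lerXn2r // nnegrE // (le_trans x0).
have [y0|y0] := leP 0 y.
  by rewrite (@le_trans _ _ 0) ?exprn_odd_le0 ?exprn_odd_ge0 // ltW.
have N z : - z ^+ a = (- z) ^+ a :> R.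
  by rewrite exprNn -signr_odd oa expr1 mulN1r.
by rewrite -lerN2 !N; apply: lerXn2r; rewrite ?nnegrE ?oppr_ge0 ?(ltW x0) ?(ltW y0) ?lerN2.
Qed.

Lemma odd_pow_homo (a b : nat) : odd a -> odd b ->
  {homo odd_pow (R := R) a b : x y / x <= y}.
Proof.
move=> oa ob x y xy; apply: exprn_odd_homo => //; rewrite leNgt; apply/negP => yx.
have := exprn_odd_homo ob (ltW yx); rewrite !odd_rootK // => yx'.
by move: yx; have -> : x = y by [apply/eqP; rewrite eq_le xy]; rewrite ltxx.
Qed.

(** The sign appears to the even power a + 1, so the product is a power of y^2; this is the source
    of the halved exponents. *)
Lemma odd_pow_mulr (a b : nat) y : odd a -> odd b ->
  odd_pow a b y * y = (y ^+ 2) `^ ((a%:R + b%:R) / (2 * b%:R)).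
Proof.
move=> oa ob; have b0 : b%:R != 0 :> R by rewrite pnatr_eq0; case: b ob.
have ab : 0 < a%:R + b%:R :> R by rewrite -natrD ltr0n addn_gt0; case: a oa.
have [->|y0] := eqVneq y 0.
  rewrite mulr0 expr0n powR0 // lt0r_neq0 // divr_gt0 // mulr_gt0 //.
  by rewrite lt0r b0 ler0n.
have -> : odd_pow a b y * y = `|y| `^ (a%:R / b%:R) * `|y|.
  rewrite /odd_pow /odd_root exprMn -(powR_mulrn a (powR_ge0 _ _)) -powRrM mulrC.
  rewrite {1}(numEsg y) mulrACA -exprS.
  have -> : Num.sg y ^+ a.+1 = 1.
    by rewrite sgr_def y0 mulr1n -exprM mulnC exprM -signr_odd /= oa expr1n.
  by rewrite mul1r mulrC [_^-1 * _]mulrC.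
rewrite -{2}(powRr1 (normr_ge0 y)) -powRD; last by rewrite normr_eq0 y0 implybT.
rewrite -real_normK ?num_real // -powR_mulrn // -powRrM; congr (_ `^ _).
by field.
Qed.

(** After dividing by the sum, each term lies in [0, 1], where t <= t^s. *)
Lemma powR_sum_le (I : finType) (z : I -> R) s : 0 < s -> s <= 1 ->
  (forall i, 0 <= z i) -> (\sum_i z i) `^ s <= \sum_i z i `^ s.
Proof.
move=> s0 s1 z0; set S := \sum_i z i.
have S0 : 0 <= S by apply: sumr_ge0.
move: S0; rewrite le0r => /orP[/eqP->|S0].
  by rewrite powR0 ?gt_eqF // sumr_ge0 // => i _; apply: powR_ge0.
rewrite -[leLHS]mulr1 -(divff (lt0r_neq0 S0)) {2}/S mulr_suml mulr_sumr.
apply: ler_sum => i _; rewrite -{2}(divfK (lt0r_neq0 S0) (z i)).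
rewrite powRM ?(divr_ge0 _ (ltW S0)) ?(ltW S0) // mulrC.
rewrite ler_pM2r ?powR_gt0 //.
have := z0 i; rewrite le0r => /orP[/eqP->|zi]; first by rewrite mul0r powR_ge0.
apply: ger1_powR => //; rewrite divr_gt0 //= ler_pdivrMr // mul1r /S (bigD1 i) //= lerDl.
exact: sumr_ge0.
Qed.

(** Tangent line at 1, obtained as Young's inequality for x and 1. *)
Lemma bernoulli_powR x s : 0 <= x -> 1 < s -> s * x - (s - 1) <= x `^ s.
Proof.
move=> x0 s1; have s0 : 0 < s by apply: lt_trans s1.
have s10 : 0 < s - 1 by rewrite subr_gt0.
have conj : s^-1 + (s / (s - 1))^-1 = 1 by field; rewrite !gt_eqF.
have := conjugate_powR x0 ler01 s0 (divr_gt0 s0 s10) conj.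
rewrite powR1 mulr1 -(ler_pM2l s0) mulrDr mulrCA divff ?gt_eqF // mulr1 => h.
rewrite lerBlDr; apply: le_trans h _; rewrite lerD2l.
by have -> : s * (1 / (s / (s - 1))) = s - 1 by field; rewrite !gt_eqF.
Qed.

(** Jensen's inequality: the tangent bound is summed over the z_i divided by their mean. *)
Lemma powR_sum_ge (I : finType) (z : I -> R) s : (0 < #|I|)%N -> 1 < s ->
  (forall i, 0 <= z i) ->
  (\sum_i z i) `^ s <= #|I|%:R `^ (s - 1) * \sum_i z i `^ s.
Proof.
move=> I0 s1 z0; set S := \sum_i z i; set N : R := #|I|%:R.
have N0 : 0 < N by rewrite ltr0n.
have s0 : 0 < s by apply: lt_trans s1.
have S0 : 0 <= S by apply: sumr_ge0.
move: S0; rewrite le0r => /orP[/eqP->|S0].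
  rewrite powR0 ?gt_eqF // mulr_ge0 ?powR_ge0 // sumr_ge0 // => i _.
  exact: powR_ge0.
have [a a0 aE] : exists2 a, 0 < a & a = S / N by exists (S / N); rewrite ?divr_gt0.
have zE i : z i `^ s = a `^ s * (z i / a) `^ s.
  by rewrite -powRM ?divr_ge0 ?(ltW a0) // mulrC divfK ?gt_eqF.
have : a `^ s * N <= \sum_i z i `^ s.
  under eq_bigr do rewrite zE.
  rewrite -mulr_sumr ler_pM2l ?powR_gt0 //.
  apply: le_trans (ler_sum _ (fun i _ => bernoulli_powR (divr_ge0 (z0 i) (ltW a0)) s1)).
  rewrite sumrB -mulr_sumr -mulr_suml -/S sumr_const -[in leRHS]mulr_natr -/N.
  suff -> : s * (S / a) - (s - 1) * N = N by [].
  by rewrite aE; field; rewrite !gt_eqF.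
move=> h; apply: le_trans (ler_wpM2l (powR_ge0 _ _) h).
rewrite (mulrCA (N `^ _)) (mulrC (N `^ _)) mulr_powRB1 ?(ltW N0) //.
rewrite -powRM ?(ltW a0) ?(ltW N0) //.
by rewrite aE divfK ?gt_eqF.
Qed.
End Powers.

(** * Finite-time extinction for a scalar differential inequality *)

Section FixedTime.
Local Open Scope classical_set_scope.
Variable R : realType.
Implicit Types (f df Y dY : R -> R) (s t : R).

Lemma mean_value f df s t : s < t ->
  (forall c, s <= c <= t -> is_derive c 1 f (df c)) ->
  exists2 c, s < c < t & f t - f s = df c * (t - s).
Proof.
move=> st fd; have [||c] := @MVT R f df s t st.
- by move=> c; rewrite in_itv /= => /andP[sc ct]; apply: fd; rewrite !ltW.
- apply: derivable_within_continuous => c; rewrite in_itv /= => cst.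
  by have [] := fd c cst.
- by rewrite in_itv /=; exists c.
Qed.

(** Y^(1-e)/(1-e) has derivative Y^(-e) Y', at most -k. Dividing by 1 - e lets one statement serve e
    > 1 and e < 1. *)
Lemma powR_decay Y dY (e k : R) s t : s < t -> e != 1 ->
  (forall c, s <= c <= t -> 0 < Y c) ->
  (forall c, s <= c <= t -> is_derive c 1 Y (dY c)) ->
  (forall c, s <= c <= t -> dY c <= - (k * Y c `^ e)) ->
  Y t `^ (1 - e) / (1 - e) <= Y s `^ (1 - e) / (1 - e) - k * (t - s).
Proof.
move=> st e1 Y0 Yd dYle; have e1' : 1 - e != 0 by rewrite subr_eq0 eq_sym.
pose f c := Y c `^ (1 - e); pose df c := (1 - e) * Y c `^ (- e) * dY c.
have fd c : s <= c <= t -> is_derive c 1 f (df c).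
  move=> cst; have Yc := Yd c cst; have Yc0 := Y0 c cst.
  have -> : df c = (1 - e) * Y c `^ (1 - e - 1) * dY c.
    by rewrite /df addrAC subrr add0r.
  by have := @is_derive1_comp R (fun x => x `^ (1 - e)) Y c _ _
    (is_derive1_powR (1 - e) Yc0) Yc.
have [c /andP[sc ct] fE] := mean_value st fd.
have cst : s <= c <= t by rewrite !ltW.
rewrite -/(f t) -/(f s) [leRHS]addrC -lerBlDr -mulrBl fE.
have -> : df c * (t - s) / (1 - e) = Y c `^ (- e) * dY c * (t - s).
  by rewrite /df; field.
rewrite -mulNr ler_wpM2r ?subr_ge0 ?(ltW st) //.
apply: le_trans (ler_wpM2l (powR_ge0 _ _) (dYle c cst)) _.
by rewrite mulrN mulrCA powRN mulVf ?mulr1 // gt_eqF // powR_gt0 // Y0.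
Qed.

(* The term in al brings Y below 1, whatever its initial value, within the    *)
(* first summand; the term in be then brings it to 0 within the second one.   *)
Lemma fixed_time_extinction Y dY (a b al be : R) :
  0 < a -> 0 < b -> 1 < al -> be < 1 ->
  (forall t, 0 < t -> 0 <= Y t) ->
  (forall t, 0 < t -> is_derive t 1 Y (dY t)) ->
  (forall t, 0 < t -> dY t <= - (a * Y t `^ al + b * Y t `^ be)) ->
  forall t, (a * (al - 1))^-1 + (b * (1 - be))^-1 < t -> Y t = 0.
Proof.
move=> a0 b0 al1 be1 Y0 Yd dYle t.
set T1 := (a * (al - 1))^-1; set T2 := (b * (1 - be))^-1 => Tt.
have al0 : 0 < al - 1 by rewrite subr_gt0.
have be0 : 0 < 1 - be by rewrite subr_gt0.
have T1_gt0 : 0 < T1 by rewrite invr_gt0 mulr_gt0.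
have T2_gt0 : 0 < T2 by rewrite invr_gt0 mulr_gt0.
have dYa c : 0 < c -> dY c <= - (a * Y c `^ al).
  move=> c0; apply: le_trans (dYle c c0) _.
  by rewrite lerN2 lerDl mulr_ge0 ?powR_ge0 ?ltW.
have dYb c : 0 < c -> dY c <= - (b * Y c `^ be).
  move=> c0; apply: le_trans (dYle c c0) _.
  by rewrite lerN2 lerDr mulr_ge0 ?powR_ge0 ?ltW.
(* Both phases are counted back from [t], so they start at a positive time, where the inequality is
   available. *)
pose s := t - T1 - T2; have s0 : 0 < s by rewrite /s; lra.
have [st1 t1t] : s < s + T1 /\ s + T1 < t by rewrite /s; split; lra.
have Tpos c : s <= c -> 0 < c by apply: lt_le_trans.
apply/eqP; rewrite eq_le Y0 ?andbT; last by apply: Tpos; rewrite ltW // (lt_trans st1).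
rewrite leNgt; apply/negP => Yt.
have Ypos c : s <= c <= t -> 0 < Y c.
  move=> /andP[sc]; rewrite le_eqVlt => /orP[/eqP->//|ct]; apply: lt_le_trans Yt _.
  have [|w /andP[cw _] YE] := @mean_value Y dY c t ct.
    by move=> w /andP[cw _]; apply: Yd; apply: Tpos; apply: le_trans cw.
  have w0 : 0 < w by apply: Tpos; rewrite (le_trans sc) // ltW.
  rewrite -subr_le0 YE pmulr_lle0 ?subr_gt0 // (le_trans (dYa w w0)) //.
  by rewrite oppr_le0 mulr_ge0 ?powR_ge0 // ltW.
have Y1 : Y (s + T1) <= 1.
  have := @powR_decay Y dY al a s (s + T1) st1.
  rewrite gt_eqF // => /(_ isT) H.
  have {H} : Y (s + T1) `^ (1 - al) / (1 - al) <=
             Y s `^ (1 - al) / (1 - al) - a * (s + T1 - s).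
    apply: H => c /andP[sc ct]; [apply: Ypos|apply: Yd|apply: dYa]; rewrite ?Tpos //.
    by rewrite sc (le_trans ct) // ltW.
  have -> : a * (s + T1 - s) = (al - 1)^-1.
    by rewrite addrAC subrr add0r /T1; field; rewrite !gt_eqF.
  have divN z : z / (1 - al) = - (z / (al - 1)) by rewrite -[1 - al]opprB invrN mulrN.
  rewrite !divN => H.
  (* Since Y s^(1-al) is positive, Y^(1-al) exceeds 1 after time T1 however large Y s is; as 1 - al
     < 0, Y is then at most 1. *)
  have {}H : (Y s `^ (1 - al) + 1) / (al - 1) <= Y (s + T1) `^ (1 - al) / (al - 1).
    by rewrite mulrDl mul1r; lra.
  move: H; rewrite ler_pM2r ?invr_gt0 // => H.
  rewrite leNgt; apply/negP => Y1.
  have : Y (s + T1) `^ (1 - al) <= 1.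
    by rewrite -[leRHS](powRr0 (Y (s + T1))) ler_powR ?(ltW Y1) // subr_le0 ltW.
  apply/negP; rewrite -ltNge; apply: lt_le_trans H.
  by rewrite ltrDr powR_gt0 // Ypos // lexx ltW // (lt_trans st1).
have := @powR_decay Y dY be b (s + T1) t t1t.
rewrite lt_eqF // => /(_ isT) H.
have {H} : Y t `^ (1 - be) / (1 - be) <=
           Y (s + T1) `^ (1 - be) / (1 - be) - b * (t - (s + T1)).
  apply: H => c /andP[sc ct].
  - by apply: Ypos; rewrite ct (le_trans (ltW st1)).
  - by apply: Yd; apply: Tpos; apply: le_trans sc; rewrite ltW.
  - by apply: dYb; apply: Tpos; apply: le_trans sc; rewrite ltW.
(* During T2, Y^(1-be) loses at least 1, but it starts at most at 1: Y t cannot be positive. *)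
have -> : b * (t - (s + T1)) = (1 - be)^-1.
  have -> : t - (s + T1) = T2 by rewrite /s; ring.
  by rewrite /T2; field; rewrite !gt_eqF.
rewrite -[X in _ / _ - X]mul1r -mulrBl ler_pM2r ?invr_gt0 //.
apply/negP; rewrite -ltNge.
apply: (@le_lt_trans _ _ 0); last by rewrite powR_gt0.
rewrite subr_le0.
rewrite -[leRHS](congr1 (@^~ (1 - be)) (powR1 R)).
apply: ge0_ler_powR; rewrite ?nnegrE ?(ltW be0) //.
by rewrite ltW // Ypos // !ltW.
Qed.
End FixedTime.

(** * Contraction, energy decay and limits of the closed-loop flow *)

Section Flow.
Local Open Scope classical_set_scope.
Variable R : realType.

Lemma left_max_derive_ge0 (f : R -> R) (d t : R) : 0 < t ->
  is_derive t 1 f d -> (forall s, 0 <= s <= t -> f s <= f t) -> 0 <= d.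
Proof.
move=> t0 /is_derive1_caratheodory[g [fE gt gd]] fmax.
rewrite leNgt -gd; apply/negP => gt0.
have /nbhs_ballP[e /= e0 eP] : \forall z \near t, g z < 0 by exact: (cvgr_lt _ gt _ gt0).
pose h := Num.min (e / 2) t.
have h0 : 0 < h by rewrite lt_min t0 divr_gt0.
have ht : h <= t by rewrite ge_min lexx orbT.
have he : h < e by rewrite gt_min ltr_pdivrMr // ltr_pMr // ltr1n.
have gth : g (t - h) < 0.
  by apply: eP; rewrite /ball /= opprB addrC subrK gtr0_norm.
have := fmax (t - h); rewrite subr_ge0 ht gerBl (ltW h0) => /(_ isT).
rewrite -subr_le0 fE addrAC subrr sub0r mulrN oppr_le0 leNgt => /negP; apply.
by rewrite nmulr_rlt0.
Qed.

Variables (n : nat) (W : 'M[R]_n) (k1 k2 : R) (m r p q : nat).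
Hypotheses (hk1 : 0 < k1) (hk2 : 0 < k2).
Hypotheses (hm : odd m) (hr : odd r) (hp : odd p) (hq : odd q).
Local Notation u := (protocol W k1 k2 m r p q).
Implicit Types (x y : R -> 'cV[R]_n) (t : R).

Definition response (e : R) := k1 * odd_pow m r e + k2 * odd_pow p q e.

Lemma protocolE (z : 'cV[R]_n) i : u z i = response (- (laplacian W *m z) i 0).
Proof.
rewrite /protocol laplacian_mulE; congr (response (- _)).
rewrite [RHS](bigID [in neighbours W i]) /= [X in _ + X]big1 ?addr0 // => j.
by rewrite inE /edge negbK => /eqP ->; rewrite normr0 mul0r.
Qed.

Lemma response_homo : {homo response : a b / a <= b}.
Proof.
move=> a b ab; rewrite /response lerD // ler_pM2l // odd_pow_homo //.
Qed.

(** Where a difference of states attains its sup norm, diagonal dominance gives L (z - w) the sign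
    of that entry; the monotone response then pushes it back. The boolean [b] encodes the sign. *)
Lemma protocol_dissipative (z w : 'cV[R]_n) i (b : bool) :
  (forall j, `|z j 0 - w j 0| <= (-1) ^+ b * (z i 0 - w i 0)) ->
  (-1) ^+ b * (u z i - u w i) <= 0.
Proof.
move=> zw; rewrite !protocolE.
have : 0 <= (-1) ^+ b * ((laplacian W *m z) i 0 - (laplacian W *m w) i 0).
  rewrite !laplacian_mulE -sumrB mulr_sumr; apply: sumr_ge0 => j _.
  have -> : (-1) ^+ b * (`|W i j| * (z i 0 - Num.sg (W i j) * z j 0) -
                         `|W i j| * (w i 0 - Num.sg (W i j) * w j 0)) =
     `|W i j| * ((-1) ^+ b * (z i 0 - w i 0) -
                  (-1) ^+ b * Num.sg (W i j) * (z j 0 - w j 0)) by ring.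
  rewrite mulr_ge0 // subr_ge0; apply: le_trans (zw j).
  apply: le_trans (ler_norm _) _; rewrite !normrM normr_sign mul1r normr_sg.
  by rewrite ler_piMl // lern1 leq_b1.
case: b {zw} => /=; rewrite ?expr1 ?expr0 ?mul1r ?mulN1r ?opprB.
  by rewrite !subr_ge0 subr_le0 => h; apply: response_homo; rewrite lerN2.
by rewrite subr_ge0 subr_le0 => h; apply: response_homo; rewrite lerN2.
Qed.

(* Maximise the penalised difference (+/-) (x_i - y_i) - k t over i, the sign *)
(* and t: by protocol_dissipative the maximum is reached at t = 0.            *)
Lemma protocol_nonexpansive x y (M : R) :
  trajectory u x -> trajectory u y ->
  (forall i, `|x 0 i 0 - y 0 i 0| <= M) ->
  forall t, 0 <= t -> forall i, `|x t i 0 - y t i 0| <= M.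
Proof.
move=> xu yu xy0 T T0 i0; apply/ler_addgt0Pl => e e0.
have M0 : 0 <= M by apply: le_trans (xy0 i0).
(* This slope keeps the penalty k T below [e], also when T = 0. *)
pose k := e / (T + 1); have k0 : 0 < k by rewrite divr_gt0 // ltr_wpDl.
pose g (j : 'I_n * bool) := fun t : R => (-1) ^+ j.2 * (x t j.1 0 - y t j.1 0) - k * t.
have g_cont j : {within `[0, T], continuous (g j)}.
  have [[xc _] [yc _]] := (xu j.1, yu j.1).
  have sub : `[0, T] `<=` `[(0 : R), +oo[.
    by move=> z /=; rewrite !in_itv /= => /andP[->].
  apply: (continuous_subspaceW sub).
  apply: within_continuousB.
    by move=> z; apply: cvgM; [exact: cvg_cst|apply: cvgB; [exact: xc|exact: yc]].
  apply: continuous_subspaceT => z; apply: cvgM; [exact: cvg_cst|exact: cvg_id].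
have /fin_all_exists[c cP] : forall j, exists c : R, 0 <= c <= T /\
    (forall t, 0 <= t <= T -> g j t <= g j c).
  move=> j; have [c cT cmax] := EVT_max T0 (g_cont j).
  by exists c; move: cT; rewrite in_itv.
pose j0 := [arg max_(j > (i0, false)) g j (c j)]%O.
have j0max j t : 0 <= t <= T -> g j t <= g j0 (c j0).
  move=> tT; apply: le_trans ((cP j).2 _ tT) _.
  by rewrite /j0; case: arg_maxP => // l _; apply.
have cle : c j0 <= 0.
  rewrite leNgt; apply/negP => c0; have /andP[_ cT] := (cP j0).1.
  have [[_ xd] [_ yd]] := (xu j0.1, yu j0.1).
  have gd : is_derive (c j0) 1 (g j0)
      ((-1) ^+ j0.2 * (u (x (c j0)) j0.1 - u (y (c j0)) j0.1) - k).
    have xd' := xd _ c0; have yd' := yd _ c0.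
    rewrite /g; apply: is_derive_eq; rewrite /=.
    by rewrite -[k%:A]/(k * 1) mulr1.
  have := left_max_derive_ge0 c0 gd _; rewrite leNgt => /(_ _)/negP[].
    move=> s /andP[s0 sc]; apply: j0max; rewrite s0 /=; exact: le_trans cT.
  rewrite subr_lt0; apply: le_lt_trans k0; apply: protocol_dissipative => j.
  have := j0max (j, x (c j0) j 0 - y (c j0) j 0 < 0) (c j0) (cP j0).1.
  by rewrite /g /= lerD2r -normrEsign.
have cj0 : c j0 = 0 by apply/eqP; rewrite eq_le cle; case/andP: (cP j0).1.
have := j0max (i0, x T i0 0 - y T i0 0 < 0) T; rewrite T0 lexx => /(_ isT).
rewrite cj0 {1}/g /= -normrEsign /g mulr0 subr0 => gT.
have kT : k * T <= e.
  by rewrite /k mulrAC ler_pdivrMr ?ltr_wpDl // ler_pM2l // lerDl.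
have : (-1) ^+ j0.2 * (x 0 j0.1 0 - y 0 j0.1 0) <= M.
  apply: le_trans (ler_norm _) _; rewrite normrM normr_sign mul1r; exact: xy0.
move: gT kT; lra.
Qed.

Lemma trajectory_continuous x t i : trajectory u x -> 0 < t ->
  {for t, continuous (fun s => x s i 0)}.
Proof.
move=> xu t0; have [_ /(_ t t0) xd] := xu i.
by apply: differentiable_continuous; apply/derivable1_diffP; case: xd.
Qed.

Hypotheses (symW : W^T = W) (hmr : (r < m)%N) (hpq : (p < q)%N) (hn : (0 < n)%N).
Local Notation quad z := ((z^T *m laplacian W *m z) 0 0).

Lemma is_derive_quadratic x t : trajectory u x -> 0 < t ->
  is_derive t 1 (fun s => quad (x s))
    (2 * \sum_i u (x t) i * (laplacian W *m x t) i 0).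
Proof.
move=> xu t0; set L := laplacian W.
have symL i j : L i j = L j i.
  by have := congr1 (fun M : 'M[R]_n => M j i) (trmx_laplacian symW); rewrite mxE.
pose F i j := (fun s => x s i 0) * (fun s => x s j 0) : R -> R.
have -> : (fun s => quad (x s)) = \sum_i \sum_j L i j \*: F i j.
  apply/funext => s; rewrite fct_sumE -mulmxA mxE; apply: eq_bigr => i _.
  rewrite fct_sumE !mxE mulr_sumr; apply: eq_bigr => j _.
  by rewrite /= /F mulrCA.
have Fd i j : is_derive t 1 (F i j)
    (x t i 0 *: u (x t) j + x t j 0 *: u (x t) i).
  have [_ /(_ t t0) di] := xu i; have [_ /(_ t t0) dj] := xu j.
  exact: is_deriveM.
apply: is_derive_eq.
pose G i j := L i j * (x t i 0 * u (x t) j).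
transitivity (\sum_i \sum_j G i j + \sum_i \sum_j G j i).
  rewrite -big_split; apply: eq_bigr => i _; rewrite -big_split.
  apply: eq_bigr => j _ /=; rewrite /G (symL j i) -mulrDr //.
rewrite [X in X + _]exchange_big -mulr2n -[LHS]mulr_natl; congr (_ * _).
apply: eq_bigr => i _.
rewrite mxE mulr_sumr; apply: eq_bigr => j _; rewrite /G symL; ring.
Qed.

Definition settling_bound (l : R) : R :=
  l^-1 * (n%:R `^ ((m%:R - r%:R) / (2 * r%:R)) / k1 * (r%:R / (m%:R - r%:R))
          + k2^-1 * (q%:R / (q%:R - p%:R))).

Variable l : R.
Hypotheses (l0 : 0 < l) (rayleigh : forall z : 'cV[R]_n,
  l * quad z <= ((laplacian W *m z)^T *m (laplacian W *m z)) 0 0).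

Let r0 : 0 < r%:R :> R. Proof. by rewrite ltr0n; case: r hr. Qed.
Let q0 : 0 < q%:R :> R. Proof. by rewrite ltr0n; case: q hq. Qed.
Let mr0 : 0 < m%:R - r%:R :> R. Proof. by rewrite subr_gt0 ltr_nat. Qed.
Let qp0 : 0 < q%:R - p%:R :> R. Proof. by rewrite subr_gt0 ltr_nat. Qed.
Let n0 : 0 < n%:R :> R. Proof. by rewrite ltr0n. Qed.

Lemma settling_bound_gt0 : 0 < settling_bound l.
Proof.
by rewrite /settling_bound mulr_gt0 ?invr_gt0 // addr_gt0 ?mulr_gt0 ?divr_gt0 ?invr_gt0 ?powR_gt0.
Qed.

Let al : R := (m%:R + r%:R) / (2 * r%:R).
Let be : R := (p%:R + q%:R) / (2 * q%:R).

(** Passing from a sum of powers to a power of the sum costs n^(al-1) for the exponent above 1,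
    whence the power of n in the bound, and nothing for the one below 1. *)
Lemma response_sum_ge (e : 'I_n -> R) (y : R) : 0 <= y -> y <= \sum_i e i ^+ 2 ->
  k1 / n%:R `^ (al - 1) * y `^ al + k2 * y `^ be <= \sum_i response (e i) * e i.
Proof.
move=> y0 yS; have S0 : 0 <= \sum_i e i ^+ 2 by apply: le_trans yS.
have al1 : 1 < al by rewrite /al ltr_pdivlMr ?mulr_gt0 // mul1r; move: mr0 => ?; lra.
have be1 : be < 1 by rewrite /be ltr_pdivrMr ?mulr_gt0 // mul1r; move: qp0 => ?; lra.
have be0 : 0 < be by rewrite /be divr_gt0 ?mulr_gt0 ?ltr_wpDl.
have -> : \sum_i response (e i) * e i =
    k1 * \sum_i (e i ^+ 2) `^ al + k2 * \sum_i (e i ^+ 2) `^ be.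
  rewrite !mulr_sumr -big_split; apply: eq_bigr => i _.
  by rewrite /response mulrDl -!mulrA !odd_pow_mulr.
have e20 i : 0 <= e i ^+ 2 by rewrite sqr_ge0.
apply: lerD.
  rewrite -mulrA ler_pM2l // mulrC ler_pdivrMr ?powR_gt0 // mulrC.
  have := @powR_sum_ge R 'I_n _ al _ al1 e20; rewrite card_ord => /(_ hn).
  apply: le_trans; apply: ge0_ler_powR; rewrite ?nnegrE //.
  by rewrite ltW // (lt_trans _ al1).
rewrite ler_pM2l //; apply: le_trans (powR_sum_le be0 (ltW be1) e20).
by apply: ge0_ler_powR; rewrite ?nnegrE // ltW.
Qed.

Lemma quadratic_extinct x t : trajectory u x -> settling_bound l < t ->
  quad (x t) = 0.
Proof.
move=> xu Tt.
have al1 : 0 < al - 1.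
  by rewrite /al subr_gt0 ltr_pdivlMr ?mulr_gt0 // mul1r; move: mr0 => ?; lra.
have be1 : 0 < 1 - be.
  by rewrite /be subr_gt0 ltr_pdivrMr ?mulr_gt0 // mul1r; move: qp0 => ?; lra.
pose Y s := l * quad (x s).
pose dY s := l * (2 * \sum_i u (x s) i * (laplacian W *m x s) i 0).
have N0 : 0 < n%:R `^ (al - 1) by apply: powR_gt0.
suff : Y t = 0 by move/eqP; rewrite mulf_eq0 gt_eqF //= => /eqP.
(* The factor 2 from differentiating the energy cancels the 2 in the denominators of al - 1 and 1 -
   be. *)
apply: (@fixed_time_extinction R Y dY (2 * l * (k1 / n%:R `^ (al - 1))) (2 * l * k2) al be).
- by rewrite !mulr_gt0 ?invr_gt0.
- by rewrite !mulr_gt0.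
- by rewrite -subr_gt0.
- by rewrite -subr_gt0.
- by move=> s _; rewrite mulr_ge0 ?(ltW l0) // quadratic_ge0.
- by move=> s s0; have := is_derive_quadratic xu s0 => ?; exact: is_deriveZ.
- move=> s s0; pose e i := - (laplacian W *m x s) i 0.
  have -> : dY s = - (2 * l * \sum_i response (e i) * e i).
    rewrite /dY mulrA [l * 2]mulrC -mulrN -sumrN; congr (_ * _).
    by apply: eq_bigr => i _; rewrite protocolE /e mulrN opprK.
  rewrite lerN2 -[2 * l * _ * _]mulrA -[2 * l * k2 * _]mulrA -mulrDr.
  rewrite ler_pM2l ?mulr_gt0 //; apply: response_sum_ge.
    by rewrite mulr_ge0 ?(ltW l0) // quadratic_ge0.
  apply: le_trans (rayleigh _) _; rewrite mxE; apply: ler_sum => i _.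
  by rewrite [X in X * _]mxE /e sqrrN expr2.
- apply: le_lt_trans Tt; rewrite le_eqVlt; apply/orP; left; apply/eqP.
  have alE : al - 1 = (m%:R - r%:R) / (2 * r%:R) by rewrite /al; field; rewrite gt_eqF.
  have beE : 1 - be = (q%:R - p%:R) / (2 * q%:R) by rewrite /be; field; rewrite gt_eqF.
  rewrite /settling_bound -alE; move: N0; set N := _ `^ _ => N0; rewrite alE beE.
  by field; rewrite !gt_eqF.
Qed.

(** Extinction is known only strictly after T; there the velocity is 0, so the mean value theorem
    makes x constant from T on, which carries the agreement back to T. *)
Lemma trajectory_stationary x : trajectory u x ->
  agreement W (x (settling_bound l)) /\
  forall t, settling_bound l <= t -> x t = x (settling_bound l).
Proof.
move=> xu; set T := settling_bound l; have T0 : 0 < T := settling_bound_gt0.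
have ag t : T < t -> agreement W (x t).
  by move=> Tt; apply: quadratic_eq0_agreement => //; exact: quadratic_extinct.
have xT t : T <= t -> x t = x T.
  rewrite le_eqVlt => /orP[/eqP->//|Tt]; apply/colP => i.
  have [_ xd] := xu i.
  have [c cT|c /andP[Tc _]] := @mean_value _ (fun s => x s i 0) (fun s => u (x s) i) T t Tt.
    by apply: xd; case/andP: cT => ? _; exact: lt_le_trans T0 _.
  rewrite protocolE (agreement_laplacian0 (ag _ Tc)) mxE oppr0.
  have -> : response 0 = 0.
    rewrite /response /odd_pow /odd_root sgr0 !mul0r !expr0n.
    by case: m hm => // m' _; case: p hp => // p' _; rewrite !mulr0 addr0.
  by rewrite mul0r => /eqP; rewrite subr_eq0 => /eqP.
split=> //; have T1 : T < T + 1 by rewrite ltrDl.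
by rewrite -(xT _ (ltW T1)); exact: ag.
Qed.

Lemma trajectory_settles x i : trajectory u x ->
  settles (fun t => x t i 0) (settling_bound l) (x (settling_bound l) i 0).
Proof.
move=> xu; split=> [|t /(trajectory_stationary xu).2 -> //].
apply: cvg_within_filter; apply: trajectory_continuous => //.
exact: settling_bound_gt0.
Qed.

Lemma trajectory_shift x (s : 'cV[R]_n) a : agreement W s -> trajectory u x ->
  trajectory u (fun t => x t + a *: s).
Proof.
move=> ags xu i; have [xc xd] := xu i.
have xsE : (fun t => (x t + a *: s) i 0) = (fun t => x t i 0) + cst (a * s i 0).
  by apply/funext => t; rewrite !mxE.
rewrite xsE; split.
  apply: within_continuousD => //; apply: continuous_subspaceT => z; exact: cvg_cst.
move=> t t0; have := xd t t0 => ?; apply: is_derive_eq.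
by rewrite addr0 !protocolE mulmxDr -scalemxAr (agreement_laplacian0 ags) scaler0 addr0.
Qed.

Lemma stability_of_trivial_agreement :
  (forall z : 'cV[R]_n, agreement W z -> z = 0) ->
  fixed_time_stability u (settling_bound l).
Proof.
move=> ag0 x xu i; have := trajectory_settles i xu.
by rewrite (ag0 _ (trajectory_stationary xu).1) mxE.
Qed.

(** Translating the initial state by a s translates the state at T by a s, so two states on one line
    along [s] cannot both be close to states ending at 0. *)
Lemma consensus_of_line_agreement (s : 'cV[R]_n) :
  (forall i, s i 0 = 1 \/ s i 0 = -1) -> agreement W s ->
  (forall z : 'cV[R]_n, agreement W z -> exists a, z = a *: s) ->
  fixed_time_bipartite_consensus u (settling_bound l).
Proof.
move=> s1 ags agline; set T := settling_bound l.
have T0 : 0 <= T by rewrite ltW // settling_bound_gt0.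
have ns i : `|s i 0| = 1 by case: (s1 i) => ->; rewrite ?normrN normr1.
pose i0 := Ordinal hn.
pose Z0 := [set z | exists x, [/\ trajectory u x, x 0 = z & x T = 0]].
(* The value is only defined on initial states that admit a trajectory, a set *)
(* not known to be closed; nonexpansiveness makes the closure harmless.       *)
exists (closure Z0).
  split; first exact: closed_closure.
  exists s.
    by apply/eqP => s0; have := ns i0; rewrite s0 mxE normr0 => /eqP; rewrite eq_sym oner_eq0.
  move=> z a zZ zaZ; apply/eqP/negPn/negP => a0.
  (* Two approximations within |a|/4 give initial distance at most |a|/2, while the final states are
     |a| apart. *)
  have e0 : 0 < `|a| / 4 by rewrite divr_gt0 ?normr_gt0.
  have [_ [[x [xu <- xT]] [_ zx]]] := zZ _ (nbhsx_ballx z _ e0).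
  have [_ [[y [yu <- yT]] [_ zy]]] := zaZ _ (nbhsx_ballx (z + a *: s) _ e0).
  have := protocol_nonexpansive (M := `|a| / 2) (trajectory_shift a ags xu) yu _ T0 i0.
  rewrite xT yT !mxE add0r subr0 normrM ns mulr1 => /(_ _)/wrap[].
    move=> i; have := zx i 0; have := zy i 0; rewrite /ball /= !mxE => h1 h2.
    have -> : x 0 i 0 + a * s i 0 - y 0 i 0 =
      (z i 0 + a * s i 0 - y 0 i 0) - (z i 0 - x 0 i 0) by ring.
    apply: le_trans (ler_normB _ _) _; move: h1 h2; lra.
  by rewrite leNgt; apply/negP; rewrite negbK ltr_pdivrMr // ltr_pMr ?normr_gt0 // ltr1n.
move=> x0; have [[x [xu x0E]]|nox] := pselect (exists x, trajectory u x /\ x 0 = x0).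
  have [agT _] := trajectory_stationary xu; have [c cE] := agline _ agT.
  exists (fun i => s i 0), c; split=> // [nZ|y yu y0 i].
    apply/eqP => c0; apply: nZ; apply: subset_closure; exists x; split=> //.
    by rewrite cE c0 scale0r.
  (* Nonexpansiveness with M = 0 is uniqueness: the value depends only on [x0]. *)
  have <- : y T i 0 = s i 0 * c.
    have := protocol_nonexpansive (M := 0) yu xu _ T0 i.
    rewrite y0 x0E => /(_ _)/wrap[j|]; first by rewrite subrr normr0.
    by rewrite normr_le0 subr_eq0 => /eqP ->; rewrite cE mxE mulrC.
  exact: trajectory_settles.
exists (fun=> 1), 1; split=> // [i|x xu xx0]; first by left.
by case: nox; exists x.
Qed.
End Flow.

(** * Spectral gap of a signed Laplacian *)

Section Spectrum.
Variables (R : realType) (n : nat) (W : 'M[R]_n) (lam : seq R).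
Hypotheses (symW : W^T = W) (lamW : ordered_spectrum (laplacian W) lam).

Let symL : (laplacian W)^T = laplacian W := trmx_laplacian symW.

Lemma size_spectrum : size lam = n.
Proof.
have := size_char_poly (laplacian W); rewrite lamW.2 size_prod_XsubC.
by case.
Qed.

Lemma mem_spectrumP a :
  reflect (exists2 x : 'cV[R]_n, x != 0 & laplacian W *m x = a *: x) (a \in lam).
Proof.
rewrite -root_prod_XsubC -lamW.2 -eigenvalue_root_char.
apply: (iffP eigenvalueP) => [[v vL v0]|[x x0 xL]].
  exists v^T; first by rewrite trmx_eq0.
  by rewrite -[laplacian W]symL -trmx_mul vL linearZ.
exists x^T; last by rewrite trmx_eq0.
by rewrite -[laplacian W]symL -trmx_mul xL linearZ.
Qed.

Lemma spectrum_ge0 a : a \in lam -> 0 <= a.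
Proof.
move=> /mem_spectrumP[x x0 xL]; have := quadratic_ge0 x symW.
rewrite -mulmxA xL -scalemxAr mxE pmulr_lge0 // mxE.
under eq_bigr do rewrite mxE -expr2.
rewrite lt0r sumr_ge0 ?andbT => [|i _]; last exact: sqr_ge0.
apply: contraNneq x0 => /eqP; rewrite psumr_eq0 => [/allP h|i _]; last exact: sqr_ge0.
apply/eqP/colP => i; rewrite mxE; have := h i; rewrite mem_index_enum => /(_ isT).
by rewrite /= sqrf_eq0 => /eqP.
Qed.

Lemma spectrum_head_le a : a \in lam -> lam`_0 <= a.
Proof.
case: lam lamW.1 => // b s /= /(order_path_min le_trans)/allP bs.
by rewrite inE => /orP[/eqP->//|/bs].
Qed.

Lemma spectrum_gap_trivial : (0 < n)%N ->
  (forall x : 'cV[R]_n, agreement W x -> x = 0) ->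
  0 < lam`_0 /\ forall a, a \in lam -> 0 <= a * (a - lam`_0).
Proof.
move=> n0 ker0; have l0 : lam`_0 \in lam by rewrite mem_nth ?size_spectrum.
split=> [|a alam]; last first.
  by apply: mulr_ge0; [exact: spectrum_ge0|rewrite subr_ge0 spectrum_head_le].
rewrite lt0r spectrum_ge0 // andbT; apply/eqP => l00.
move: l0; rewrite l00 => /mem_spectrumP[x x0]; rewrite scale0r => xL.
by move: x0; rewrite (ker0 x) ?eqxx //; exact: laplacian0_agreement.
Qed.

(** The eigenvalue 0 occurs, and only once because the kernel is a line; the list being sorted, the
    next entry is positive and nothing lies between. *)
Lemma spectrum_gap_line (s : 'cV[R]_n) : (1 < n)%N -> s != 0 -> agreement W s ->
  (forall x, agreement W x -> exists a, x = a *: s) ->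
  0 < lam`_1 /\ forall a, a \in lam -> 0 <= a * (a - lam`_1).
Proof.
move=> n1 s0 ags agline.
have lam0 : 0 \in lam.
  by apply/mem_spectrumP; exists s => //; rewrite agreement_laplacian0 ?scale0r.
have simple : (count_mem 0%R lam <= 1)%N.
  apply: (kernel_line_simple symL lamW.2 (v := s)) => x xL.
  by apply: agline; exact: laplacian0_agreement.
have := spectrum_head_le lam0; have := spectrum_ge0; have := size_spectrum.
move: simple lam0 lamW.1; case: lam => [|b [|c t]] /=;
  try by move=> _ _ _ nE; move: n1; rewrite -nE.
move=> simple _ /andP[_ /(order_path_min le_trans)/allP ct] _ ge0 b0.
have {}b0 : b = 0 by apply/eqP; rewrite eq_le b0 ge0 ?mem_head.
have c0 : 0 < c.
  rewrite lt0r ge0 ?andbT; last by rewrite !inE eqxx orbT.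
  by apply/eqP => c0; move: simple; rewrite b0 c0 eqxx.
split=> // a; rewrite !inE b0 => /or3P[/eqP->|/eqP->|/ct ca].
- by rewrite mul0r.
- by rewrite subrr mulr0.
- by rewrite mulr_ge0 ?subr_ge0 // (le_trans (ltW c0)).
Qed.
End Spectrum.

Theorem theorem3 (R : realType) (n : nat) (A : 'M[R]_n) (k1 k2 : R)
    (m r p q : nat) (lam : seq R)
    (hn : (2 <= n)%N)
    (hA : signed_digraph A)
    (hconn : strongly_connected A)
    (hk1 : 0 < k1) (hk2 : 0 < k2)
    (hm : odd m) (hr : odd r) (hp : odd p) (hq : odd q)
    (hmr : (r < m)%N) (hpq : (p < q)%N)
    (hlam : ordered_spectrum (laplacian (mirror A)) lam) :
  (structurally_balanced A ->
     exists T : R,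
       [/\ 0 <= T,
           T <= (lam`_1)^-1 *
                (n%:R `^ ((m%:R - r%:R) / (2 * r%:R)) / k1 * (r%:R / (m%:R - r%:R))
                 + k2^-1 * (q%:R / (q%:R - p%:R)))
         & fixed_time_bipartite_consensus (protocol (mirror A) k1 k2 m r p q) T]) /\
  (~ structurally_balanced A ->
     exists T : R,
       [/\ 0 <= T,
           T <= (lam`_0)^-1 *
                (n%:R `^ ((m%:R - r%:R) / (2 * r%:R)) / k1 * (r%:R / (m%:R - r%:R))
                 + k2^-1 * (q%:R / (q%:R - p%:R)))
         & fixed_time_stability (protocol (mirror A) k1 k2 m r p q) T]).
Proof.
have n0 : (0 < n)%N by apply: leq_trans hn.
have symW := trmx_mirror A; have symL := trmx_laplacian symW.
split=> [bal|unb].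
  have [s [s1 ags agline]] := balanced_agreement hA hconn (Ordinal n0) bal.
  have s0 : s != 0.
    apply/eqP => s0; have := s1 (Ordinal n0); rewrite s0 mxE => -[/eqP|/eqP].
      by rewrite eq_sym oner_eq0.
    by rewrite eq_sym oppr_eq0 oner_eq0.
  have [l0 gap] := spectrum_gap_line symW hlam hn s0 ags agline.
  have ray x := rayleigh_of_spectrum x symL hlam.2 gap.
  (* The settling time is taken equal to the announced bound. *)
  exists (settling_bound n k1 k2 m r p q lam`_1); split=> //.
    exact/ltW/settling_bound_gt0.
  exact: consensus_of_line_agreement s1 ags agline.
have ker0 x : agreement (mirror A) x -> x = 0.
  exact: unbalanced_agreement_eq0.
have [l0 gap] := spectrum_gap_trivial symW hlam n0 ker0.
have ray x := rayleigh_of_spectrum x symL hlam.2 gap.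
exists (settling_bound n k1 k2 m r p q lam`_0); split=> //.
  exact/ltW/settling_bound_gt0.
exact: stability_of_trivial_agreement.
Qed.
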